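(* Let $1\le r<\infty$. If $(\Sigma,\mu)$ is a measure space with a ball-basis $\mathscr{B}$, then the multilinear Hardy--Littlewood maximal operator $$\mathcal{M}_{\mathscr{B},r}(\vec f)(x):=\sup_{B\in\mathscr{B}:x\in B}\prod_{i=1}^m\langle f_i\rangle_{B,r}\quad\text{if }x\in\bigcup_{B\in\mathscr{B}}B,\qquad\mathcal{M}_{\mathscr{B},r}(\vec f)(x):=0\text{ otherwise},$$ is a multilinear bounded oscillation operator with respect to $\mathscr{B}$ and $r$.
   Context: Ball-basis. A family $\mathscr{B}$ of measurable subsets of a measure space $(\Sigma,\mu)$ is a ball-basis if: (B1) $0<\mu(B)<\infty$ for all $B\in\mathscr{B}$; (B2) for all $x,y\in\Sigma$ some $B\in\mathscr{B}$ contains both; (B3) for every $\varepsilon>0$ and measurable $E$ there is a finite or infinite sequence $\{B_k\}\subset\mathscr{B}$ with $\mu(E\Delta\bigcup_kB_k)<\varepsilon$; (B4) there is a universal constant $\mathfrak{C}_0\ge1$ and for each $B\in\mathscr{B}$ a set $B^*\in\mathscr{B}$ (fixed once and for all) with $\mu(B^* )\le\mathfrak{C}_0\mu(B)$, $\bigcup\{B'\in\mathscr{B}:B'\cap B\ne\emptyset,\ \mu(B')\le2\mu(B)\}\subset B^*$, and $A\subset B\Rightarrow A^*\subset B^*$. Notation. $\vec f=(f_1,\ldots,f_m)$, $\vec f\mathbf{1}_E=(f_1\mathbf{1}_E,\ldots,f_m\mathbf{1}_E)$, $\langle f\rangle_{B,r}:=(\frac1{\mu(B)}\int_B|f|^rd\mu)^{1/r}$,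 $\lfloor f\rfloor_{B,r}:=\sup_{B'\in\mathscr{B},\,B'\supset B}\langle f\rangle_{B',r}$. A real-valued operator $T$ is $m$-sublinear if in each entry $|T(\ldots,\lambda f_i,\ldots)|=|\lambda||T(\ldots,f_i,\ldots)|$ and $|T(\ldots,f_i+g_i,\ldots)|\le|T(\ldots,f_i,\ldots)|+|T(\ldots,g_i,\ldots)|$. A real-valued $m$-linear or $m$-sublinear operator $T$ is a multilinear bounded oscillation operator with respect to $\mathscr{B}$ and $r\in[1,\infty)$ if there are constants $\mathfrak{C}_1(T),\mathfrak{C}_2(T)\in(0,\infty)$ such that: (T1) for every $B_0\in\mathscr{B}$ with $B_0^*\subsetneq\Sigma$ there is $B\in\mathscr{B}$ with $B\supsetneq B_0$ such that for all $\vec f\in L^r(\Sigma,\mu)^m$, $\sup_{x\in B_0}|T(\vec f\mathbf{1}_{B^*})(x)-T(\vec f\mathbf{1}_{B_0^*})(x)|\le\mathfrak{C}_1(T)\prod_{i=1}^m\langle f_i\rangle_{B^*,r}$; (T2) for every $B\in\mathscr{B}$ and all $\vec f\in L^r(\Sigma,\mu)^m$, $\sup_{x,x'\in B}|(T(\vec f)-T(\vec f\mathbf{1}_{B^*}))(x)-(T(\vec f)-T(\vec f\mathbf{1}_{B^*}))(x')|\le\mathfrak{C}_2(T)\prod_{i=1}^m\lfloor f_i\rfloor_{B,r}$.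
   Formalization: The maximal function of L^r functions may be +∞ at some points, so ''real-valued'' is read as ''finite almost everywhere'' (proved as part of the claim), and in (T1), (T2) differences are taken at every point with the convention ∞−∞=0. *)

(* Defs.v *)
From HB Require Import structures.
From mathcomp Require Import all_boot all_order all_algebra.
From mathcomp Require Import all_classical all_reals all_analysis.

Set Implicit Arguments.
Unset Strict Implicit.
Unset Printing Implicit Defensive.

Import Order.TTheory GRing.Theory Num.Theory.
Import numFieldNormedType.Exports.

Local Open Scope classical_set_scope.
Local Open Scope ring_scope.
Local Open Scope ereal_scope.

Section BallBasis.
Context {R : realType} {d : measure_display} {S : measurableType d}.
Variable mu : {measure set S -> \bar R}.

(* [star] is the fixed choice B |-> B^*; only its values on [BB] matter.
   A finite or infinite (possibly empty) sequence of balls enters (B3) only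
   through its union, hence as a countable subfamily of [BB]. *)
Record ball_basis (BB : set (set S)) (star : set S -> set S) : Prop :=
  BallBasis {
    ball_measurable : forall B, BB B -> measurable B ;
    ball_B1 : forall B, BB B -> 0 < mu B /\ mu B < +oo ;
    ball_B2 : forall x y : S, exists B, [/\ BB B, B x & B y] ;
    ball_B3 : forall (e : R) (E : set S), (0 < e)%R -> measurable E ->
      exists F : set (set S), [/\ countable F, F `<=` BB &
        mu (E `+` \bigcup_(B in F) B) < e%:E] ;
    ball_B4 : exists C0 : R, [/\ (1 <= C0)%R,
      forall B, BB B ->
        [/\ BB (star B), mu (star B) <= C0%:E * mu B &
          \bigcup_(B' in [set B' | [/\ BB B', B' `&` B !=set0 &
                                       mu B' <= 2%:E * mu B]]) B'
            `<=` star B] &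
      forall A B, BB A -> BB B -> A `<=` B -> star A `<=` star B]
  }.

Definition avg (r : R) (B : set S) (f : S -> R) : \bar R :=
  ((mu B)^-1 * \int[mu]_(x in B) (`|f x| `^ r)%:E) `^ r^-1.

Definition sup_avg (BB : set (set S)) (r : R) (B : set S) (f : S -> R) :
    \bar R :=
  ereal_sup [set avg r B' f | B' in [set B' | BB B' /\ B `<=` B']].

Definition restr (m : nat) (f : 'I_m -> S -> R) (E : set S) : 'I_m -> S -> R :=
  fun i x => (f i x * \1_E x)%R.

Definition in_Lr (r : R) (m : nat) (f : 'I_m -> S -> R) : Prop :=
  forall i, f i \in Lfun mu r%:E.

(* Operators such as maximal functions may be infinite on a null set, so the
   codomain is \bar R; being real-valued means being finite a.e. on L^r
   arguments. *)
Definition operator (m : nat) := ('I_m -> S -> R) -> S -> \bar R.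

Definition real_valued (m : nat) (r : R) (T : operator m) : Prop :=
  forall f, in_Lr r f -> {ae mu, forall x, T f x \is a fin_num}.

Definition m_linear (m : nat) (r : R) (T : operator m) : Prop :=
  (forall f i (a : R) x, in_Lr r f ->
     T [eta f with i |-> (fun y => a * f i y)%R] x = a%:E * T f x) /\
  (forall f i (g : S -> R) x, in_Lr r f -> g \in Lfun mu r%:E ->
     T f x +? T [eta f with i |-> g] x ->
     T [eta f with i |-> (fun y => f i y + g y)%R] x =
       T f x + T [eta f with i |-> g] x).

Definition m_sublinear (m : nat) (r : R) (T : operator m) : Prop :=
  (forall f i (a : R) x, in_Lr r f ->
     `|T [eta f with i |-> (fun y => a * f i y)%R] x| = `|a|%:E * `|T f x|) /\
  (forall f i (g : S -> R) x, in_Lr r f -> g \in Lfun mu r%:E ->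
     `|T [eta f with i |-> (fun y => f i y + g y)%R] x| <=
       `|T f x| + `|T [eta f with i |-> g] x|).

(* Subtraction with oo - oo = 0, whereas the library has +oo - +oo = -oo. It is
   the usual subtraction at finite values, and the oscillation conditions below
   constrain T at every point, including those where it is infinite. *)
Definition esub (a b : \bar R) : \bar R := if a == b then 0 else a - b.

Definition cond_T1 (BB : set (set S)) (star : set S -> set S)
    (m : nat) (r : R) (T : operator m) (C1 : R) : Prop :=
  forall B0, BB B0 -> star B0 `<` setT ->
  exists B, [/\ BB B, B0 `<` B &
    forall f, in_Lr r f ->
      ereal_sup [set `|esub (T (restr f (star B)) x)
                            (T (restr f (star B0)) x)| | x in B0]
        <= C1%:E * \prod_(i < m) avg r (star B) (f i)].

Definition cond_T2 (BB : set (set S)) (star : set S -> set S)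
    (m : nat) (r : R) (T : operator m) (C2 : R) : Prop :=
  forall B, BB B -> forall f, in_Lr r f ->
    ereal_sup [set `|esub (esub (T f x) (T (restr f (star B)) x))
                          (esub (T f x') (T (restr f (star B)) x'))|
              | x in B & x' in B]
      <= C2%:E * \prod_(i < m) sup_avg BB r B (f i).

Definition bounded_oscillation (BB : set (set S)) (star : set S -> set S)
    (m : nat) (r : R) (T : operator m) : Prop :=
  [/\ real_valued r T,
      m_linear r T \/ m_sublinear r T &
      exists C1 C2 : R, [/\ (0 < C1)%R, (0 < C2)%R,
        cond_T1 BB star r T C1 & cond_T2 BB star r T C2]].

Definition maximal_operator (BB : set (set S)) (m : nat) (r : R) :
    operator m :=
  fun f x =>
    if x \in \bigcup_(B in BB) B then
      ereal_sup [set \prod_(i < m) avg r B (f i) | B in [set B | BB B /\ B x]]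
    else 0.

End BallBasis.

(* Main.v *)
Require Import Defs.
From mathcomp Require Import all_boot all_order all_algebra.
From mathcomp Require Import all_classical all_reals all_analysis.
From mathcomp Require Import measurable_realfun.
Import Order.TTheory GRing.Theory Num.Theory.

Set Implicit Arguments.
Unset Strict Implicit.
Unset Printing Implicit Defensive.

Local Open Scope classical_set_scope.
Local Open Scope ring_scope.

(** Write [M] for the maximal operator. Every point lies in a ball, so [M f x]
is a supremum over a nonempty family of products of averages.

It is finite almost everywhere because [M f] is at most the product of the
maximal functions of the entries, so that one entry suffices. For one entry
there is a weak-type estimate. By a greedy Vitali selection, the balls [B]
with [l * mu B < \int_B |f|^r] are covered by the enlargements [star (D n)]
of disjoint balls [D n] of the same family, and the covering set [G] satisfies
[l * mu G <= C0 * \int |f|^r]. An arbitrary union of balls need not be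
measurable, so the estimate is stated for such a measurable cover [G]; letting
[l] grow, the intersection of the covers is null and contains every point at
which the maximal function is infinite ([maximal_ae_lty]).

Sublinearity is Minkowski's inequality on each ball, multiplied by the averages
of the other entries.

Both oscillation bounds come from one comparison. Localizing [f] to a set [E]
decreases [M f x] by at most [K] as soon as every ball around [x] either lies
in [E], where nothing changes, or has a product of averages at most [K]
([maximal_operator_localization]).
For [cond_T2], take [E = star B]. A ball [B'] around a point of [B] that is not
inside [star B] has [mu B' > 2 * mu B], hence [B] is contained in [star B'],
and the averages over [B'] are at most [C0] times those over [star B'].
For [cond_T1], choose among the balls meeting [B0] of measure above [2 * mu B0] one
whose measure is within a factor 2 of the infimum, and let [B] be its
enlargement. Then [mu (star B) <= 2 * C0 ^+ 2 * mu B'] for every ball [B']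
around a point of [B0] that is not inside [star B0], so the averages over such
[B'] of the entries localized to [star B] are at most [2 * C0 ^+ 2] times the
averages over [star B]. *)

(** * Extended real numbers *)

Section ereal_facts.
Context {R : realType}.
Local Open Scope ereal_scope.
Implicit Types (a b t K : \bar R).

Lemma ereal_archimedean_eq0 t (K : R) :
  0 <= t -> (forall n : nat, n%:R%:E * t <= K%:E) -> t = 0.
Proof.
move=> t0 h; apply/eqP; rewrite eq_le t0 andbT leNgt; apply/negP => tpos.
case: t t0 tpos h => [t| |//] t0 tpos h; last first.
  by have := h 1%N; rewrite mul1e leye_eq.
rewrite lte_fin in tpos.
have := h (Num.truncn (K / t)).+1; apply/negP; rewrite -ltNge lte_fin.
rewrite -ltr_pdivrMr//.
exact: truncnS_gt.
Qed.

Lemma lee_prode m (a b : 'I_m -> \bar R) :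
  (forall i, 0 <= a i) -> (forall i, a i <= b i) ->
  \prod_(i < m) a i <= \prod_(i < m) b i.
Proof.
move=> a0 ab.
suff /andP[] : 0 <= \prod_(i < m) a i <= \prod_(i < m) b i by [].
apply: (big_ind2 (fun x y => 0 <= x <= y)) => [|x1 x2 y1 y2|i _].
- by rewrite lee01 lexx.
- by move=> /andP[? ?] /andP[? ?]; rewrite mule_ge0//= lee_pmul.
- by rewrite a0 ab.
Qed.

Lemma prodeZl m (c : R) (a : 'I_m -> \bar R) :
  \prod_(i < m) (c%:E * a i) = (c ^+ m)%:E * \prod_(i < m) a i.
Proof. by rewrite big_split/= prodEFin prodr_const card_ord. Qed.

Lemma ge0_le_poweR a b (s : R) :
  (0 <= s)%R -> 0 <= a -> a <= b -> a `^ s <= b `^ s.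
Proof.
move=> s0 a0 ab; apply: gt0_ler_poweR => //; rewrite in_itv/= leey andbT//.
exact: le_trans ab.
Qed.

(** In the applications [A] is the average over a fixed ball. *)
Lemma prodeD1 (T : Type) m (A : T -> \bar R) (f : 'I_m -> T) i :
  \prod_(j < m) A (f j) = A (f i) * \prod_(j < m | j != i) A (f j).
Proof. by rewrite (bigD1 i). Qed.

Lemma prode_with (T : Type) m (A : T -> \bar R) (f : 'I_m -> T) i (g : T) :
  \prod_(j < m) A ([eta f with i |-> g] j) =
  A g * \prod_(j < m | j != i) A (f j).
Proof.
rewrite (bigD1 i)//= eqxx; congr (_ * _).
by apply: eq_bigr => j /negPf ->.
Qed.

Lemma lee_prode_withD (T : Type) m (A : T -> \bar R) (f : 'I_m -> T) i
    (g h : T) :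
  (forall u : T, 0 <= A u) -> A h <= A (f i) + A g ->
  \prod_(j < m) A ([eta f with i |-> h] j) <=
  \prod_(j < m) A (f j) + \prod_(j < m) A ([eta f with i |-> g] j).
Proof.
move=> A0 hD; rewrite !prode_with (prodeD1 _ _ i) -ge0_muleDl//.
by apply: lee_wpmul2r => //; exact: prode_ge0.
Qed.

(** When [b] is infinite so is [a], and then [esub a b] is 0. *)
Lemma esub_bounds a b K :
  0 <= b -> 0 <= K -> b <= a -> a <= maxe b K -> 0 <= esub a b <= K.
Proof.
move=> b0 K0 ba abK; rewrite /esub; case: eqP => [_|/eqP ab].
  by rewrite lexx K0.
have bfin : b \is a fin_num.
  rewrite fin_numElt (lt_le_trans _ b0) ?ltNyr//=.
  by rewrite (@lt_le_trans _ _ a) ?leey// lt_neqAle eq_sym ab.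
rewrite sube_ge0//; last by rewrite bfin.
rewrite ba/= leeBlDr//; apply: le_trans abK _.
by rewrite ge_max leeDr//= leeDl.
Qed.

Lemma abse_esub_le a b K :
  0 <= a <= K -> 0 <= b <= K -> `|esub a b| <= K.
Proof.
move=> /andP[a0 aK] /andP[b0 bK]; rewrite /esub.
have K0 : 0 <= K by exact: le_trans aK.
case: eqP => [_|/eqP ab]; first by rewrite abse0.
case: K a b => [k| |//] [a| |] [b| |]//= in a0 aK b0 bK K0 ab *;
  rewrite ?leey//.
rewrite lee_fin ler_norml; rewrite !lee_fin in a0 aK b0 bK.
rewrite lerBlDr lerBrDr (le_trans aK) ?lerDl// andbT.
by rewrite (le_trans _ a0)// addrC subr_le0.
Qed.

End ereal_facts.

(** * Averages over a set *)

Section averages.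
Context {R : realType} {d : measure_display} {S : measurableType d}.
Variables (mu : {measure set S -> \bar R}) (r : R).
Hypothesis r1 : 1 <= r.
Local Open Scope ereal_scope.
Implicit Types (f g : S -> R) (B D E : set S).

Let r0 : (0 < r)%R. Proof. exact: lt_le_trans r1. Qed.
Let r_neq0 : (r != 0)%R. Proof. by rewrite gt_eqF. Qed.
Let rV_ge0 : (0 <= r^-1)%R. Proof. by rewrite invr_ge0 ltW. Qed.

Lemma avg_ge0 B f : 0 <= avg mu r B f.
Proof. exact: poweR_ge0. Qed.

Lemma integral_normr_powR_ge0 B f : 0 <= \int[mu]_(x in B) (`|f x| `^ r)%:E.
Proof. by apply: integral_ge0 => x _; rewrite lee_fin powR_ge0. Qed.

Lemma measurable_normr_powR B f :
  measurable_fun setT f -> measurable_fun B (fun x => (`|f x| `^ r)%:E).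
Proof.
move=> mf; apply: measurable_funS (@subsetT _ B) _ => //.
apply/measurable_EFinP.
apply: (measurableT_comp (measurable_powR r)) => //.
exact: measurableT_comp.
Qed.

Lemma integral_normr_powR_mkcond B f :
  \int[mu]_(x in B) (`|f x| `^ r)%:E =
  \int[mu]_x (`|f x * \1_B x| `^ r)%:E.
Proof.
rewrite integral_mkcond; apply: eq_integral => x _.
rewrite patchE indicE; case: ifPn => _; first by rewrite mulr1.
by rewrite mulr0 normr0 powR0.
Qed.

(** This form gives access to Minkowski's inequality. *)
Lemma avg_Lnorm B f : avg mu r B f =
  (mu B)^-1 `^ r^-1 * 'N[mu]_(r%:E)[EFin \o (fun x => f x * \1_B x)%R].
Proof.
rewrite /avg poweRM ?inve_ge0 ?measure_ge0 ?integral_normr_powR_ge0//.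
rewrite integral_normr_powR_mkcond unlock; congr (_ * _ `^ _).
Qed.

Lemma avgD_le B f g : measurable B ->
  measurable_fun setT f -> measurable_fun setT g ->
  avg mu r B (fun x => f x + g x)%R <= avg mu r B f + avg mu r B g.
Proof.
move=> mB mf mg; rewrite !avg_Lnorm -ge0_muleDr ?Lnorm_ge0//.
rewrite lee_wpmul2l ?poweR_ge0//.
have m1 (h : S -> R) : measurable_fun setT h ->
    measurable_fun setT (fun x => h x * \1_B x)%R.
  by move=> mh; apply: measurable_funM => //; exact: measurable_indic.
apply: le_trans (minkowski_EFin mu (m1 _ mf) (m1 _ mg) r1).
rewrite le_eqVlt; apply/orP; left; apply/eqP; congr Lnorm.
by apply/funext => x /=; rewrite mulrDl.
Qed.

Lemma avgZ B (a : R) f : measurable B -> measurable_fun setT f ->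
  avg mu r B (fun x => a * f x)%R = `|a|%:E * avg mu r B f.
Proof.
move=> mB mf; rewrite /avg.
under eq_integral do rewrite normrM powRM// EFinM.
rewrite ge0_integralZl_EFin ?powR_ge0//; last first.
  exact: measurable_normr_powR.
rewrite muleCA poweRM ?lee_fin ?powR_ge0//; last first.
  by rewrite mule_ge0 ?inve_ge0 ?measure_ge0 ?integral_normr_powR_ge0.
by rewrite poweR_EFin -powRrM divff// powRr1.
Qed.

(** Comparing the two normalizations gives the factor [c `^ r^-1], which is at
most [c] because [1 <= c] and [1 <= r]. *)
Lemma avg_le_scale (c : R) B D f g : (1 <= c)%R ->
  0 < mu B -> mu B < +oo -> 0 < mu D -> mu D <= c%:E * mu B ->
  \int[mu]_(x in B) (`|f x| `^ r)%:E <= \int[mu]_(x in D) (`|g x| `^ r)%:E ->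
  avg mu r B f <= c%:E * avg mu r D g.
Proof.
move=> c1 muB0 muBoo muD0 muDB fg.
have c0 : (0 < c)%R by exact: lt_le_trans c1.
have [b b0 muBE] : exists2 b, (0 < b)%R & mu B = b%:E.
  exists (fine (mu B)); first by rewrite fine_gt0// muB0.
  by rewrite fineK// ge0_fin_numE// ltW.
have [e e0 muDE] : exists2 e, (0 < e)%R & mu D = e%:E.
  have muDoo : mu D < +oo by rewrite (le_lt_trans muDB)// muBE -EFinM ltry.
  exists (fine (mu D)); first by rewrite fine_gt0// muD0.
  by rewrite fineK// ge0_fin_numE// ltW.
rewrite muBE muDE -EFinM lee_fin in muDB.
rewrite /avg muBE muDE !inver !gt_eqF//.
set I := (X in (_ * X) `^ _ <= _); set J := (X in _ <= _ * (_ * X) `^ _).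
have I0 : 0 <= I by exact: integral_normr_powR_ge0.
have J0 : 0 <= J by exact: integral_normr_powR_ge0.
rewrite -/I -/J in fg; clearbody I J.
apply: (@le_trans _ _ ((c%:E * (e^-1%:E * J)) `^ r^-1)).
  apply: ge0_le_poweR => //.
  - by rewrite mule_ge0// lee_fin invr_ge0 ltW.
  - rewrite muleA lee_pmul//; first by rewrite lee_fin invr_ge0 ltW.
    by rewrite -EFinM lee_fin ler_pdivlMr// mulrC ler_pdivrMr.
rewrite poweRM ?lee_fin ?(ltW c0)//; last first.
  by rewrite mule_ge0// lee_fin invr_ge0 ltW.
rewrite lee_wpmul2r ?poweR_ge0// poweR_EFin lee_fin.
rewrite -[leRHS]powRr1 ?(ltW c0)//; apply: ler_powR => //.
by rewrite invf_le1.
Qed.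

Lemma avg_gt (l : R) B f : (0 <= l)%R -> 0 < mu B -> mu B < +oo ->
  l%:E `^ r^-1 < avg mu r B f ->
  l%:E * mu B < \int[mu]_(x in B) (`|f x| `^ r)%:E.
Proof.
move=> l0 muB0 muBoo; rewrite !ltNge; apply: contra => I_le.
have [b b0 muBE] : exists2 b, (0 < b)%R & mu B = b%:E.
  exists (fine (mu B)); first by rewrite fine_gt0// muB0.
  by rewrite fineK// ge0_fin_numE// ltW.
have bV0 : 0 <= (b^-1)%:E by rewrite lee_fin invr_ge0 ltW.
apply: ge0_le_poweR; first exact: rV_ge0.
- by rewrite mule_ge0 ?inve_ge0 ?measure_ge0 ?integral_normr_powR_ge0.
- by rewrite muBE inver gt_eqF// lee_pdivrMl// muleC -muBE.
Qed.

Lemma integral_restr_le m (f : 'I_m -> S -> R) i B E :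
  measurable B -> measurable E -> measurable_fun setT (f i) ->
  \int[mu]_(x in B) (`|restr f E i x| `^ r)%:E <=
  \int[mu]_(x in E) (`|f i x| `^ r)%:E.
Proof.
move=> mB mE mf; rewrite [leRHS]integral_normr_powR_mkcond.
apply: ge0_subset_integral => //.
apply: measurable_normr_powR.
by apply: measurable_funM => //; exact: measurable_indic.
Qed.

Lemma avg_restr_le m (f : 'I_m -> S -> R) i B E :
  measurable B -> measurable E -> measurable_fun setT (f i) ->
  avg mu r B (restr f E i) <= avg mu r B (f i).
Proof.
move=> mB mE mf.
have mrf : measurable_fun setT (restr f E i).
  by apply: measurable_funM => //; exact: measurable_indic.
apply: ge0_le_poweR; first exact: rV_ge0.
- by rewrite mule_ge0 ?inve_ge0 ?measure_ge0 ?integral_normr_powR_ge0.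
- apply: lee_wpmul2l; first by rewrite inve_ge0 measure_ge0.
  apply: ge0_le_integral => //; try exact: measurable_normr_powR.
  move=> x _; rewrite lee_fin ge0_ler_powR ?(ltW r0) ?nnegrE//.
  rewrite /restr normrM indicE; case: (x \in E).
    by rewrite normr1 mulr1.
  by rewrite normr0 mulr0.
Qed.

Lemma avg_restr_id m (f : 'I_m -> S -> R) i B E :
  B `<=` E -> avg mu r B (restr f E i) = avg mu r B (f i).
Proof.
move=> BE; apply: (congr1 (fun I => ((mu B)^-1 * I) `^ r^-1)).
apply: eq_integral => x.
by rewrite inE => Bx; rewrite /restr indicE mem_set ?mulr1//; exact: BE.
Qed.

End averages.

(** * Vitali selection and finiteness almost everywhere *)

Section vitali.
Context {R : realType} {d : measure_display} {S : measurableType d}.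
Variable mu : {measure set S -> \bar R}.
Local Open Scope ereal_scope.

(** At each step the next set is taken among those of [F] disjoint from the ones
already chosen, with measure at least half the supremum; [D n = set0] once none
is left. A set [B] of [F] is then either hit for a first time, by some [D n]
that was chosen when [B] was still a candidate, or it is a candidate at every
step. *)
Lemma greedy_disjoint_sequence (F : set (set S)) (M : R) :
  (forall B, F B -> 0 < mu B) -> (forall B, F B -> mu B <= M%:E) ->
  exists D : nat -> set S, [/\ trivIset setT D,
    forall n, F (D n) \/ D n = set0 &
    forall B, F B ->
      (exists n, [/\ F (D n), B `&` D n !=set0 & mu B <= 2%:E * mu (D n)]) \/
      (forall n, F (D n) /\ mu B <= 2%:E * mu (D n))].
Proof.
move=> Fpos FM.
have next U : exists C : set S,
    ((exists2 B, F B & B `&` U = set0) ->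
      [/\ F C, C `&` U = set0 &
        forall B, F B -> B `&` U = set0 -> mu B <= 2%:E * mu C]) /\
    (~ (exists2 B, F B & B `&` U = set0) -> C = set0).
  have [[B0 FB0 B0U]|noB] := pselect (exists2 B, F B & B `&` U = set0);
    last by exists set0.
  pose V := [set mu B | B in [set B | F B /\ B `&` U = set0]].
  have sV : ereal_sup V \is a fin_num.
    have le1 : ereal_sup V <= M%:E.
      by apply: ge_ereal_sup => _ [B [FB _] <-]; exact: FM.
    have ge1 : 0 <= ereal_sup V.
      apply: le_trans (ereal_sup_ubound _); last by exists B0.
      exact: measure_ge0.
    by rewrite ge0_fin_numE// (le_lt_trans le1) ?ltry.
  have sV0 : 0 < ereal_sup V.
    by apply: lt_le_trans (Fpos _ FB0) _; apply: ereal_sup_ubound; exists B0.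
  have e0 : (0 < fine (ereal_sup V) / 2)%R.
    by rewrite divr_gt0// fine_gt0// sV0 -ge0_fin_numE// ltW.
  have [_ [C [FC CU] <-] Cbig] := ub_ereal_sup_adherent e0 sV.
  exists C; split => [_|]; last by case; exists B0.
  split => // B FB BU; apply: (@le_trans _ _ (ereal_sup V)).
    by apply: ereal_sup_ubound; exists B.
  move: Cbig; rewrite -[in X in X -> _](fineK sV) -EFinB.
  rewrite {1}[fine _]splitr addrK => Cbig.
  rewrite -(fineK sV) -lee_pdivrMl// -EFinM mulrC; exact: ltW.
have [g gP] := choice next.
(* U n is the union of the sets chosen before step n *)
pose U := fix U n := if n is n'.+1 then U n' `|` g (U n') else set0.
have UD n k : (k < n)%N -> g (U k) `<=` U n.
  elim: n => // n IH; rewrite ltnS leq_eqVlt => /orP[/eqP ->|/IH kn] x gx.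
    by right.
  by left; exact: kn.
have gU n : g (U n) `&` U n = set0.
  have [ex|nex] := pselect (exists2 B, F B & B `&` U n = set0).
    by have [/(_ ex) []] := gP (U n).
  by have [_ /(_ nex) ->] := gP (U n); rewrite set0I.
exists (g \o U); split => [|n|B FB] /=.
- apply: ltn_trivIset => n k kn.
  rewrite -subset0 -(gU n) setIC => x [xk xn]; split => //; exact: (UD _ _ kn).
- have [ex|nex] := pselect (exists2 B, F B & B `&` U n = set0).
    by left; have [/(_ ex) []] := gP (U n).
  by right; have [_ /(_ nex) ->] := gP (U n).
have good n : B `&` U n = set0 -> F (g (U n)) /\ mu B <= 2%:E * mu (g (U n)).
  move=> BU; have ex : exists2 B, F B & B `&` U n = set0 by exists B.
  by have [/(_ ex) [FC _ le] _] := gP (U n); split => //; exact: le.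
have [disj|ndisj] := pselect (forall n, B `&` U n = set0).
  by right => n; exact: good.
left; have {ndisj} /existsNP[n ndisj] := ndisj.
elim: n ndisj => [|n IH ndisj]; first by rewrite setI0.
have [BU|/IH//] := pselect (B `&` U n = set0).
have [FC le] := good _ BU.
exists n; split => //; apply/set0P/eqP => BC; apply: ndisj.
by rewrite /= setIUr BU BC setU0.
Qed.

Variables (BB : set (set S)) (star : set S -> set S).
Hypothesis hBB : ball_basis mu BB star.

(** The second alternative of [greedy_disjoint_sequence] cannot occur here: the
disjoint sets [D n] would have measures bounded below, while the integral of
[h] over their union is finite. *)
Lemma maximal_weak_type (h : S -> \bar R) :
  measurable_fun setT h -> (forall x, 0 <= h x) -> \int[mu]_x h x < +oo ->
  exists K : R, forall l : R, (0 < l)%R -> exists G, [/\ measurable G,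
    (forall B, BB B -> l%:E * mu B < \int[mu]_(x in B) h x -> B `<=` G) &
    l%:E * mu G <= K%:E].
Proof.
move=> mh h0 hoo; have [C0 [C01 starP _]] := ball_B4 hBB.
have I0 : 0 <= \int[mu]_x h x by exact: integral_ge0.
set I := \int[mu]_x h x in hoo I0 *.
have Ifin : I \is a fin_num by rewrite ge0_fin_numE.
exists (C0 * fine I)%R => l l0.
pose F := [set B | BB B /\ l%:E * mu B < \int[mu]_(x in B) h x].
have intI B : measurable B -> \int[mu]_(x in B) h x <= I.
  by move=> mB; exact: ge0_subset_integral.
have Fpos B : F B -> 0 < mu B by move=> [/(ball_B1 hBB)[]].
have FM B : F B -> mu B <= (l^-1 * fine I)%:E.
  move=> [BBB lB]; rewrite EFinM fineK// lee_pdivlMl//.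
  by apply: le_trans (ltW lB) (intI _ _); exact: (ball_measurable hBB).
have [D [tD DF DP]] := greedy_disjoint_sequence Fpos FM.
have mD n : measurable (D n).
  by have [[/(ball_measurable hBB)]|->] := DF n.
have sumD : l%:E * \sum_(n <oo) mu (D n) <= I.
  rewrite -nneseriesZl//.
  apply: (@le_trans _ _ (\sum_(n <oo) \int[mu]_(x in D n) h x)).
    apply: lee_nneseries => [n _ _|n _].
      by rewrite mule_ge0 ?measure_ge0// lee_fin ltW.
    have [[_ /ltW//]|->] := DF n.
    by rewrite measure0 mule0 integral_set0.
  rewrite -ge0_integral_bigcup//; last exact: measurable_funTS.
  by apply: intI; exact: bigcup_measurable.
pose E n := if pselect (F (D n)) then star (D n) else set0.
have mE n : measurable (E n).
  rewrite /E; case: pselect => /= [[BBD _]|_] //.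
  by apply: (ball_measurable hBB); have [] := starP _ BBD.
exists (\bigcup_n E n); split => [|B BBB lB|].
- exact: bigcup_measurable.
- have [[n [FDn BDn le]]|inf] := DP B (conj BBB lB).
    move=> x Bx; exists n => //; rewrite /E; case: pselect => //= _.
    by have [_ _] := starP _ FDn.1; apply; exists B.
  have muB0 : mu B = 0.
    apply: (@ereal_archimedean_eq0 _ _ (2 * (l^-1 * fine I)%R)).
      exact: measure_ge0.
    move=> n; rewrite EFinM EFinM fineK//.
    apply: (@le_trans _ _ (2%:E * \sum_(n <oo) mu (D n))); last first.
      by rewrite lee_wpmul2l// lee_pdivlMl.
    rewrite -nneseriesZl//.
    apply: (@le_trans _ _ (\sum_(0 <= k < n) 2%:E * mu (D k))); last first.
      by apply: nneseries_lim_ge => *; rewrite mule_ge0 ?measure_ge0.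
    apply: (@le_trans _ _ (\sum_(0 <= k < n) mu B)).
      elim: n => [|n IH]; first by rewrite big_geq// mul0e.
      rewrite big_nat_recr//= -[n.+1]addn1 natrD EFinD ge0_muleDl// mul1e.
      by rewrite leeD2r.
    by apply: lee_sum => k _; have [] := inf k.
  by have := (ball_B1 hBB BBB).1; rewrite muB0 ltxx.
rewrite EFinM fineK//.
apply: (@le_trans _ _ (l%:E * \sum_(n <oo) (C0%:E * mu (D n)))).
  apply: lee_wpmul2l; first by rewrite lee_fin ltW.
  apply: (@le_trans _ _ (\sum_(n <oo) mu (E n))).
    by apply: measure_sigma_subadditive => //; exact: bigcup_measurable.
  apply: lee_nneseries => [n _ _|n _]; first exact: measure_ge0.
  rewrite /E; case: pselect => /= [FDn|_].
    by have [_ ? _] := starP _ FDn.1.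
  by rewrite measure0 mule_ge0 ?measure_ge0// lee_fin (le_trans ler01).
rewrite nneseriesZl//.
by rewrite muleCA lee_wpmul2l// lee_fin (le_trans ler01).
Qed.

(** For each [n], the points where the maximal function is infinite lie in the
cover [G n] at height [n.+1], and [mu (G n)] tends to 0. *)
Lemma maximal_ae_lty (r : R) (f : S -> R) : (1 <= r)%R ->
  f \in Lfun mu r%:E ->
  {ae mu, forall x, ereal_sup [set avg mu r B f | B in [set B | BB B /\ B x]]
     < +oo}.
Proof.
move=> r1 fL.
have mf : measurable_fun setT f by move: fL => /andP[]; rewrite inE.
have /integrableP[mh hoo] := Lfun_integrable r1 fL.
pose h x := (`|f x| `^ r)%:E.
have h0 x : 0 <= h x by rewrite lee_fin powR_ge0.
have hoo' : \int[mu]_x h x < +oo.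
  by under eq_integral do rewrite -(gee0_abs (h0 _)).
have [K GP] := maximal_weak_type mh h0 hoo'.
have /choice[G {}GP] := fun n => GP n.+1%:R (ltr0Sn _ n).
have mG n : measurable (G n) by have [] := GP n.
have mGG : measurable (\bigcap_n G n) by exact: bigcap_measurable.
exists (\bigcap_n G n); split => //.
  apply: (@ereal_archimedean_eq0 _ _ K); first exact: measure_ge0.
  move=> n; have [_ _] := GP n; apply: le_trans.
  apply: lee_pmul; rewrite ?measure_ge0 ?lee_fin ?ler_nat//.
  by apply: le_measure; rewrite ?inE//; exact: bigcap_inf.
move=> x /= /negP; rewrite -leNgt leye_eq => /eqP supx n _.
have [|_ [B [BBB Bx] <-] avgB] := @ereal_sup_gt _
    [set avg mu r B f | B in [set B | BB B /\ B x]] (n.+1%:R%:E `^ r^-1).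
  by rewrite supx poweR_EFin ltry.
have [_ + _] := GP n; apply; first exact: BBB; last exact: Bx.
have [B0 Boo] := ball_B1 hBB BBB.
exact: (avg_gt r1).
Qed.

End vitali.

(** * The maximal operator *)

Section maximal_operator.
Context {R : realType} {d : measure_display} {S : measurableType d}.
Variables (mu : {measure set S -> \bar R}).
Variables (BB : set (set S)) (star : set S -> set S).
Hypothesis hBB : ball_basis mu BB star.
Variables (m : nat) (r : R).
Hypothesis r1 : (1 <= r)%R.
Local Open Scope ereal_scope.
Implicit Types (f : 'I_m -> S -> R) (B E : set S) (x : S).

Local Notation M := (@maximal_operator R d S mu BB m r).

Let mball B : BB B -> measurable B. Proof. exact: (ball_measurable hBB). Qed.

Let le_double B : mu B <= 2%:E * mu B.
Proof. by rewrite lee_pemull// lee1n. Qed.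

Lemma ball_star B : BB B -> BB (star B).
Proof. by have [C0 [_ starP _]] := ball_B4 hBB => /starP[]. Qed.

Lemma sub_star B B' x : BB B -> BB B' -> B x -> B' x ->
  mu B' <= 2%:E * mu B -> B' `<=` star B.
Proof.
have [C0 [_ starP _]] := ball_B4 hBB.
move=> BBB BB' Bx B'x le y B'y; have [_ _] := starP _ BBB; apply.
by exists B' => //; split => //; exists x.
Qed.

Lemma ball_sub_star B : BB B -> B `<=` star B.
Proof. by move=> BBB x Bx; exact: (@sub_star B B x). Qed.

Lemma Lfun_measurable (g : S -> R) :
  g \in Lfun mu r%:E -> measurable_fun setT g.
Proof. by move=> /andP[]; rewrite inE. Qed.

Lemma measurable_restr f E i : measurable E ->
  measurable_fun setT (f i) -> measurable_fun setT (restr f E i).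
Proof.
by move=> mE mf; apply: measurable_funM => //; exact: measurable_indic.
Qed.

Lemma restr_restr f E E' : E' `<=` E -> restr (restr f E) E' = restr f E'.
Proof.
move=> sub; apply/funext => i; apply/funext => y; rewrite /restr -mulrA.
congr (_ * _)%R; rewrite !indicE; case: (boolP (y \in E')) => E'y.
  by rewrite mem_set ?mulr1//; apply: sub; rewrite inE in E'y.
by rewrite mulr0.
Qed.

Lemma maximal_operatorE f x : M f x =
  ereal_sup [set \prod_(i < m) avg mu r B (f i) | B in [set B | BB B /\ B x]].
Proof.
rewrite /maximal_operator mem_set//.
by have [B [BBB Bx _]] := ball_B2 hBB x x; exists B.
Qed.

Lemma maximal_operator_ge f B x : BB B -> B x ->
  \prod_(i < m) avg mu r B (f i) <= M f x.
Proof.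
by move=> BBB Bx; rewrite maximal_operatorE; apply: ereal_sup_ubound; exists B.
Qed.

Lemma maximal_operator_le f x K :
  (forall B, BB B -> B x -> \prod_(i < m) avg mu r B (f i) <= K) -> M f x <= K.
Proof.
move=> h; rewrite maximal_operatorE.
by apply: ge_ereal_sup => _ [B [BBB Bx] <-]; exact: h.
Qed.

Lemma maximal_operator_ge0 f x : 0 <= M f x.
Proof.
have [B [BBB Bx _]] := ball_B2 hBB x x.
apply: le_trans (maximal_operator_ge f BBB Bx).
by apply: prode_ge0 => i _; exact: avg_ge0.
Qed.

Lemma maximal_operator_real_valued : real_valued mu r M.
Proof.
move=> f fL.
pose s i x := ereal_sup [set avg mu r B (f i) | B in [set B | BB B /\ B x]].
have sL i : \forall x \ae mu, s i x < +oo.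
  exact: (maximal_ae_lty hBB r1 (fL i)).
have : \forall x \ae mu, forall i, s i x < +oo by exact: filter_forall.
apply: filterS => x supf.
rewrite ge0_fin_numE ?maximal_operator_ge0//.
apply: (@le_lt_trans _ _ (\prod_(i < m) s i x)).
  apply: maximal_operator_le => B BBB Bx; apply: lee_prode => i.
    exact: avg_ge0.
  by apply: ereal_sup_ubound; exists B.
rewrite ltey_eq prode_fin_num ?orbT// => i _.
rewrite ge0_fin_numE; first exact: supf.
have [B [BBB Bx _]] := ball_B2 hBB x x.
apply: le_trans (ereal_sup_ubound _); last by exists B.
exact: avg_ge0.
Qed.

Lemma m_sublinear_ge0 (T : operator m) :
  (forall f x, 0 <= T f x) ->
  (forall f i (a : R) x, in_Lr mu r f ->
     T [eta f with i |-> (fun y => a * f i y)%R] x = `|a|%:E * T f x) ->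
  (forall f i (g : S -> R) x, in_Lr mu r f -> g \in Lfun mu r%:E ->
     T [eta f with i |-> (fun y => f i y + g y)%R] x <=
       T f x + T [eta f with i |-> g] x) ->
  m_sublinear mu r T.
Proof.
move=> T0 TZ TD; split => [f i a x fL|f i g x fL gL].
  by rewrite !gee0_abs//; exact: TZ.
by rewrite !gee0_abs//; exact: TD.
Qed.

Lemma maximal_operator_sublinear : m_sublinear mu r M.
Proof.
apply: m_sublinear_ge0 => [|f i a x fL|f i g x fL gL].
- exact: maximal_operator_ge0.
- apply: etrans (maximal_operatorE _ _) _.
  apply: etrans (congr1 (mule _) (esym (maximal_operatorE f x))).
  apply: etrans _ (ereal_supZl _ _) => //; last first.
    have [B [BBB Bx _]] := ball_B2 hBB x x.
    by apply/set0P; exists (\prod_(i < m) avg mu r B (f i)); exists B.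
  rewrite image_comp; congr ereal_sup.
  apply: eq_imagel => B [BBB Bx] /=.
  apply: etrans (prode_with _ _ _ _) _.
  rewrite avgZ//; first last.
  - exact: Lfun_measurable.
  - exact: mball.
  by rewrite -muleA -prodeD1.
- apply: maximal_operator_le => B BBB Bx.
  apply: le_trans (leeD (maximal_operator_ge f BBB Bx)
                        (maximal_operator_ge _ BBB Bx)).
  apply: lee_prode_withD => [h|]; first exact: avg_ge0.
  by apply: avgD_le => //; [exact: mball|exact: Lfun_measurable..].
Qed.

(** Averages over balls inside [E] do not see the localization, and the other
balls contribute at most [K] to the supremum defining [M f x]. *)
Lemma maximal_operator_localization f E x K :
  (forall i, measurable_fun setT (f i)) -> measurable E -> 0 <= K ->
  (forall B, BB B -> B x ->
     B `<=` E \/ \prod_(i < m) avg mu r B (f i) <= K) ->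
  0 <= esub (M f x) (M (restr f E) x) <= K.
Proof.
move=> mf mE K0 h.
apply: esub_bounds; [exact: maximal_operator_ge0|exact: K0| |].
  apply: maximal_operator_le => B BBB Bx.
  apply: le_trans (maximal_operator_ge f BBB Bx).
  apply: lee_prode => i; first exact: avg_ge0.
  by apply: avg_restr_le => //; exact: mball.
apply: maximal_operator_le => B BBB Bx; rewrite le_max.
have [BE|->] := h B BBB Bx; last by rewrite orbT.
apply/orP; left; apply: le_trans (maximal_operator_ge _ BBB Bx).
apply: lee_prode => i; first exact: avg_ge0.
have /eqP := avg_restr_id mu r f i BE.
by rewrite eq_le => /andP[_ le_restr]; exact: le_restr.
Qed.

(** If [star B0] misses a point [y], a ball joining [y] to a point of [B0] has
measure above [2 * mu B0], so the balls to choose from exist. *)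
Lemma exists_almost_minimal_large_ball B0 : BB B0 -> star B0 `<` setT ->
  exists B, [/\ BB B, B `&` B0 !=set0, 2%:E * mu B0 < mu B &
    forall B', BB B' -> B' `&` B0 !=set0 -> 2%:E * mu B0 < mu B' ->
      mu B <= 2%:E * mu B'].
Proof.
move=> BB0 [_ /existsNP[y /not_implyP[_ nstar]]].
have [B00 B0oo] := ball_B1 hBB BB0.
have [z B0z] : B0 !=set0.
  by apply/set0P/eqP => B0E; move: B00; rewrite B0E measure0 ltxx.
pose A := [set B | [/\ BB B, B `&` B0 !=set0 & 2%:E * mu B0 < mu B]].
have [B1 AB1] : A !=set0.
  have [B [BBB By Bz]] := ball_B2 hBB y z; exists B; split => //.
    by exists z.
  rewrite ltNge; apply/negP => small; apply: nstar.
  exact: (@sub_star B0 B z).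
pose v := ereal_inf (mu @` A).
have v_le B : A B -> v <= mu B.
  by move=> AB; apply: ereal_inf_lbound; exists B.
have v0 : 0 < v.
  apply: (@lt_le_trans _ _ (2%:E * mu B0)); first by rewrite mule_gt0.
  by apply: le_ereal_inf_tmp => _ [B [_ _ /ltW ?] <-].
have vfin : v \is a fin_num.
  rewrite ge0_fin_numE ?ltW//; apply: le_lt_trans (v_le _ AB1) _.
  by have [BB1 _ _] := AB1; exact: (ball_B1 hBB BB1).2.
have e0 : (0 < fine v)%R by rewrite fine_gt0// v0 -ge0_fin_numE// ltW.
have [_ [B [BBB BB0' Blarge] <-] Bv] := lb_ereal_inf_adherent e0 vfin.
exists B; split => // B' BB' B'B0 B'large.
apply: (@le_trans _ _ (2%:E * v)); last first.
  by apply: lee_wpmul2l => //; exact: v_le.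
by apply: ltW; rewrite -/v fineK// in Bv; rewrite mule_natl mule2n.
Qed.

(** The ball required by [cond_T1] is [star B] for the almost minimal [B]. In
[2 * C0 ^+ 2], each [C0] comes from one of the two enlargements leading from
[B] to [star (star B)], and the 2 from almost minimality. *)
Lemma maximal_operator_T1 :
  exists2 C1 : R, (0 < C1)%R & cond_T1 mu BB star r M C1.
Proof.
have [C0 [C01 starP star_mono]] := ball_B4 hBB.
have C00 : (0 < C0)%R by exact: lt_le_trans C01.
have C1_gt0 : (0 < (2 * C0 ^+ 2) ^+ m)%R.
  by rewrite exprn_gt0// mulr_gt0// exprn_gt0.
exists ((2 * C0 ^+ 2) ^+ m)%R => //.
move=> B0 BB0 B0T.
have [B [BBB [z [Bz B0z]] Blarge Bmin]] :=
  exists_almost_minimal_large_ball BB0 B0T.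
have [BBs mus _] := starP _ BBB.
have [BBss muss _] := starP _ BBs.
have B0_star : B0 `<=` star B.
  apply: (@sub_star B B0 z) => //; apply: le_trans (le_double _) _.
  exact: le_trans (ltW Blarge) (le_double _).
exists (star B); split => //.
  split => // star_B0; move: Blarge; apply/negP; rewrite -leNgt.
  apply: le_trans (le_double _).
  apply: le_measure; rewrite ?inE; try exact: mball.
  exact: subset_trans (ball_sub_star BBB) star_B0.
move=> f fL; apply: ge_ereal_sup => _ [x B0x <-].
set E := star (star B); set K := (X in _ <= X).
have mf i : measurable_fun setT (f i) by exact: Lfun_measurable.
have mE : measurable E by exact: mball.
(* both operators are now applied to localizations of the same [restr f E] *)
rewrite -(@restr_restr f E (star B0)); last exact: star_mono.
have K0 : 0 <= K.
  apply: mule_ge0; first by rewrite lee_fin ltW.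
  by apply: prode_ge0 => i _; exact: avg_ge0.
suff /andP[e0 eK] : 0 <= esub (M (restr f E) x)
    (M (restr (restr f E) (star B0)) x) <= K by rewrite (gee0_abs e0).
apply: maximal_operator_localization;
  [|exact: mball (ball_star BB0)|exact: K0|].
  by move=> i; exact: measurable_restr.
move=> B' BB' B'x.
have [small|large] := leP (mu B') (2%:E * mu B0).
  by left; exact: (@sub_star B0 B' x).
right; rewrite /K -prodeZl; apply: lee_prode => i; first exact: avg_ge0.
have [B'0 B'oo] := ball_B1 hBB BB'.
apply: (avg_le_scale r1 _ B'0 B'oo).
- by rewrite mulr_ege1 ?exprn_ege1 ?ler1n.
- exact: (ball_B1 hBB BBss).1.
- apply: le_trans muss _; rewrite mulrC expr2 -mulrA EFinM -muleA.
  apply: lee_wpmul2l; first by rewrite lee_fin ltW.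
  apply: le_trans mus _; rewrite EFinM -muleA.
  apply: lee_wpmul2l; first by rewrite lee_fin ltW.
  by apply: Bmin => //; exists x.
- by apply: integral_restr_le => //; exact: mball.
Qed.

(** A large ball [B'] around a point of [B] need not contain [B], but [star B']
does and so enters [sup_avg]; this costs one factor [C0] per entry. *)
Lemma maximal_operator_T2 :
  exists2 C2 : R, (0 < C2)%R & cond_T2 mu BB star r M C2.
Proof.
have [C0 [C01 starP _]] := ball_B4 hBB.
have C00 : (0 < C0)%R by exact: lt_le_trans C01.
have C2_gt0 : (0 < C0 ^+ m)%R by rewrite exprn_gt0.
exists (C0 ^+ m)%R => //.
move=> B BBB f fL.
have mf i : measurable_fun setT (f i) by exact: Lfun_measurable.
set K := (X in _ <= X).
have sup_avg_ge B' i : BB B' -> B `<=` B' ->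
    avg mu r B' (f i) <= sup_avg mu BB r B (f i).
  by move=> BB' sub; apply: ereal_sup_ubound; exists B'.
have K0 : 0 <= K.
  apply: mule_ge0; first by rewrite lee_fin ltW.
  apply: prode_ge0 => i _.
  by apply: le_trans (sup_avg_ge B i BBB _) => //; exact: avg_ge0.
suff osc x : B x -> 0 <= esub (M f x) (M (restr f (star B)) x) <= K.
  apply: ge_ereal_sup => _ [x Bx [x' Bx' <-]].
  exact: abse_esub_le (osc _ Bx) (osc _ Bx').
move=> Bx; apply: maximal_operator_localization;
  [exact: mf|exact: mball (ball_star BBB)|exact: K0|].
move=> B' BB' B'x.
have [B'0 B'oo] := ball_B1 hBB BB'.
have [BBs' mus' _] := starP _ BB'.
have [small|large] := leP (mu B') (2%:E * mu B).
  by left; exact: (@sub_star B B' x).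
right; rewrite /K -prodeZl; apply: lee_prode => i; first exact: avg_ge0.
have B_star : B `<=` star B'.
  apply: (@sub_star B' B x) => //.
  exact: le_trans (le_double _) (le_trans (ltW large) (le_double _)).
apply: (@le_trans _ _ (C0%:E * avg mu r (star B') (f i))).
  apply: (avg_le_scale r1 C01 B'0 B'oo _ mus').
    exact: (ball_B1 hBB BBs').1.
  apply: ge0_subset_integral => //; [exact: mball..| |exact: ball_sub_star].
  exact: measurable_normr_powR.
by apply: lee_wpmul2l; [rewrite lee_fin ltW|exact: sup_avg_ge].
Qed.

End maximal_operator.

Theorem theorem2p1 (R : realType) (d : measure_display) (S : measurableType d)
    (mu : {measure set S -> \bar R})
    (BB : set (set S)) (star : set S -> set S) (m : nat) (r : R)
    (hm : (0 < m)%N) (hr : 1 <= r) (hBB : ball_basis mu BB star) :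
  bounded_oscillation mu BB star r (@maximal_operator R d S mu BB m r).
Proof.
split.
- exact: maximal_operator_real_valued hBB _ _ hr.
- by right; exact: maximal_operator_sublinear hBB _ _ hr.
- have [C1 C1_gt0 T1] := maximal_operator_T1 hBB m hr.
  have [C2 C2_gt0 T2] := maximal_operator_T2 hBB m hr.
  by exists C1, C2.
Qed.
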